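(* Let $M\in\mathbb{R}^{m\times n}$ with $m\ge n$ have full rank, let $M=WH$ be its polar decomposition, and let $H=V\Sigma V^\top$ with $V\in\mathbb{R}^{n\times n}$ orthogonal and $\Sigma=\operatorname{diag}(\sigma_1,\dots,\sigma_n)$ be an eigenvalue decomposition of $H$. Let $\mathcal L(M)=\ell(W,H)$ be a differentiable scalar loss, and let $\overline W$ and $\overline H$ be the gradients of $\ell$ with respect to $W$ and $H$. Set $$C:=\bigl(\overline H-W^\top\overline W\,H^{-1}\bigr)_{\mathrm{sym}}.$$ Define the matrix $T\in\mathbb{R}^{n\times n}$ by $$T_{ij}:=\begin{cases}\dfrac{1}{\sigma_i+\sigma_j}, & \sigma_i+\sigma_j>0,\\[4pt] 0, & \sigma_i+\sigma_j=0,\end{cases}\qquad 1\le i,j\le n,$$ and $X:=V\bigl(T\odot(V^\top C V)\bigr)V^\top$. Then the gradient $\overline M$ of $\mathcal L$ with respect to $M$ is $$\overline M=\overline W\,H^{-1}+2MX.$$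
   Context: The polar decomposition of $M\in\mathbb{R}^{m\times n}$, $m\ge n$, is $M=WH$ where $W\in\mathbb{R}^{m\times n}$ satisfies $W^\top W=I_n$ and $H\in\mathbb{R}^{n\times n}$ is symmetric positive semidefinite (when $M$ has full rank, $W$ and $H$ are unique and $H$ is positive definite). If $M=U\Sigma V^\top$ is a thin SVD, then $W=UV^\top$ and $H=V\Sigma V^\top$, so the $\sigma_i$ are the singular values of $M$. The loss $\mathcal L$ is the function on full-rank matrices $M$ obtained by composing $\ell$ with the map sending $M$ to its polar factors $(W,H)$. For a scalar loss and a variable $Y$, $\overline Y$ denotes the gradient with respect to $Y$ in the Frobenius inner product $\langle A,B\rangle=\operatorname{tr}(A^\top B)$; thus $\mathrm d\ell=\langle\overline W,\mathrm dW\rangle+\langle\overline H,\mathrm dH\rangle$ and $\mathrm d\mathcal L=\langle\overline M,\mathrm dM\rangle$. For square $A$, $A_{\mathrm{sym}}=\tfrac12(A+A^\top)$. The symbol $\odot$ is the entrywise (Hadamard) product. *)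

(* Defs.v *)
From HB Require Import structures.
From mathcomp Require Import all_boot all_order all_algebra.
From mathcomp Require Import all_classical all_reals all_analysis.
Set Implicit Arguments.
Unset Strict Implicit.
Unset Printing Implicit Defensive.
Import Order.TTheory GRing.Theory Num.Theory.
Import numFieldNormedType.Exports.
Local Open Scope classical_set_scope.
Local Open Scope ring_scope.

Definition psdmx (R : realType) (n : nat) (H : 'M[R]_n) : Prop :=
  H^T = H /\ forall x : 'cV[R]_n, 0 <= (x^T *m H *m x) 0 0.

Definition is_polar (R : realType) (m n : nat)
    (M W : 'M[R]_(m, n)) (H : 'M[R]_n) : Prop :=
  [/\ M = W *m H, W^T *m W = 1%:M & psdmx H].

(* The value is determined by M when M has full rank; on rank-deficient M the
   factor W is an arbitrary choice, which does not affect differentials at a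
   full-rank matrix since the full-rank matrices form an open set. *)
Definition polar_factors (R : realType) (m n : nat) (M : 'M[R]_(m, n)) :
    'M[R]_(m, n) * 'M[R]_n :=
  get [set WH | is_polar M WH.1 WH.2].

Definition frobenius (R : realType) (m n : nat) (A B : 'M[R]_(m, n)) : R :=
  \tr (A^T *m B).

Definition is_gradient (R : realType) (m n : nat)
    (f : 'M[R]_(m, n) -> R) (Y G : 'M[R]_(m, n)) : Prop :=
  differentiable f Y /\ forall dY, 'd f Y dY = frobenius G dY.

Definition symmx_part (R : realType) (n : nat) (A : 'M[R]_n) : 'M[R]_n :=
  2^-1 *: (A + A^T).

Definition hadamard (R : realType) (m n : nat) (A B : 'M[R]_(m, n)) :
    'M[R]_(m, n) :=
  map2_mx *%R A B.

(* Main.v *)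
Require Import Defs.
From HB Require Import structures.
From mathcomp Require Import all_boot all_order all_algebra.
From mathcomp Require Import all_classical all_reals all_analysis.
From mathcomp Require Import ring lra.
Set Implicit Arguments.
Unset Strict Implicit.
Unset Printing Implicit Defensive.
Import Order.TTheory GRing.Theory Num.Theory.
Import numFieldNormedType.Exports.
Local Open Scope ring_scope.

(** The proof differentiates the polar factors by perturbing the two equations
    [H^2 = M^T M] and [W H = M], then transposes the resulting linear map.

    Let [M + h = W' H'] be a polar decomposition, and put [E = H' - H] and
    [D = H'^2 - H^2 = M^T h + h^T M + h^T h].  Since [H E + E H = D - E^2], one
    has [E = S (D - E^2)], where [S] inverts the Sylvester operator
    [Y |-> H Y + Y H]; in the eigenbasis [V] of [H], [S] is the entrywise
    multiplication by [1 / (sigma_i + sigma_j)] (sylvesterK, sylvester_unique).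

    A bound on [E] comes before any choice of a branch of the square root:
    [D = H E + E H'] gives [<E, D> = tr (E^T H E) + tr (E^T H' E)], which is at
    least [c |E|^2] when [H >= c I] and [H'] is semidefinite
    (psd_sqrt_lipschitz).  Hence [E = O(h)] for every polar decomposition of
    [M + h], so that [E = S (M^T h + h^T M) + O(h^2)], and
    [W' - W = (h - W' E) H^-1] yields the expansion of [W'].  The same estimate
    at [h = 0] is uniqueness of the polar factors of [M].

    Existence of a polar decomposition of [M + h], for small [h], is obtained
    from the same equation: [E |-> S (D - E^2)] is a contraction of a small
    ball, its fixed point is symmetric because the map commutes with
    transposition, and [H + E] is positive definite because it is close to [H]
    (psd_sqrt_near).

    So the polar factors are differentiable at [M] (polar_factors_diff), with
    [dH = S (M^T h + h^T M)] and [dW = (h - W dH) H^-1], and the chain rule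
    gives [dL = <Wbar H^-1, h> + <Hbar - W^T Wbar H^-1, dH>].  As [dH] is
    symmetric and [S] is self-adjoint (sylvester_selfadjoint), the second term
    is [<S C, M^T h + h^T M> = 2 <M X, h>] with [X = S C]. *)

(** * Norm estimates and differentiability criteria on matrix spaces *)

Lemma mx_norm_entry (R : realType) m n (A : 'M[R]_(m, n)) i j :
  `|A i j| <= `|A|.
Proof.
rewrite [leRHS]/Num.norm /= mx_normrE; apply/bigmax_geP; right => /=.
by exists (i, j).
Qed.

Lemma mx_norm_le (R : realType) m n (A : 'M[R]_(m, n)) (e : R) :
  0 <= e -> (forall i j, `|A i j| <= e) -> `|A| <= e.
Proof.
move=> e0 Ae; rewrite [leLHS]/Num.norm /= mx_normrE.
by apply/bigmax_le => // -[i j] _; exact: Ae.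
Qed.

Lemma trmx_norm (R : realType) m n (A : 'M[R]_(m, n)) : `|A^T| = `|A|.
Proof.
apply/eqP; rewrite eq_le; apply/andP; split; apply: mx_norm_le => // i j.
  by rewrite mxE mx_norm_entry.
by rewrite -[A]trmxK mxE trmxK mx_norm_entry.
Qed.

Lemma mulmx_norm (R : realType) m p n (A : 'M[R]_(m, p)) (B : 'M[R]_(p, n)) :
  `|A *m B| <= p%:R * `|A| * `|B|.
Proof.
apply: mx_norm_le => [|i j]; first by rewrite !mulr_ge0.
rewrite mxE (le_trans (ler_norm_sum _ _ _))//.
have /le_trans -> // : \sum_(k < p) `|A i k * B k j| <=
    \sum_(k < p) `|A| * `|B|.
  by apply: ler_sum => k _; rewrite normrM ler_pM ?mx_norm_entry.
by rewrite sumr_const card_ord -mulrA mulr_natl lexx.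
Qed.

(** Expanding [A] on the matrix units bounds [f A] by the sum of the norms of
    the images of these units; the added 1 makes the constant positive even
    if [f] is zero. *)
Lemma linear_mx_bounded (R : realType) m n (V : normedModType R)
    (f : {linear 'M[R]_(m, n) -> V}) :
  exists2 k : R, 0 < k & forall A, `|f A| <= k * `|A|.
Proof.
exists (1 + \sum_i \sum_j `|f (delta_mx i j)|) => [|A].
  by rewrite ltr_pwDl// sumr_ge0// => i _; rewrite sumr_ge0.
rewrite {1}(matrix_sum_delta A) linear_sum (le_trans (ler_norm_sum _ _ _))//.
rewrite mulrDl mul1r ler_wpDl// mulr_suml ler_sum// => i _.
rewrite linear_sum (le_trans (ler_norm_sum _ _ _))// mulr_suml ler_sum// => j _.
by rewrite linearZ /= normrZ mulrC ler_wpM2l// mx_norm_entry.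
Qed.

Lemma linear_mx_continuous (R : realType) m n (V : normedModType R)
    (f : {linear 'M[R]_(m, n) -> V}) : continuous f.
Proof.
apply/linear_bounded_continuous/bounded_funP => r.
have [k k0 fk] := linear_mx_bounded f.
by exists (k * r) => A Ar; rewrite (le_trans (fk A))// ler_wpM2l// ltW.
Qed.

(** A remainder [O(h^2)] is [o(h)]; this turns explicit second-order estimates
    into differentiability. *)
Lemma quadratic_remainder_diff (R : realType) (V W : normedModType R)
    (f : V -> W) (df : {linear V -> W}) (x : V) (K : R) :
  continuous df ->
  (\forall h \near 0, `|f (h + x) - (f x + df h)| <= K * `|h| ^+ 2) ->
  differentiable f x /\ 'd f x = df :> (V -> W).
Proof.
move=> dfc hK.
have ho : f \o shift x = cst (f x) + df +o_0 id.
  apply/eqaddoP => e e0; near=> h.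
  rewrite !fctE /=.
  have := near hK h; rewrite /= => /(_ _)/le_trans -> //.
  rewrite expr2 mulrA ler_wpM2r//.
  rewrite (@le_trans _ _ ((`|K| + 1) * `|h|))//.
    by rewrite ler_wpM2r// (le_trans (ler_norm _))// lerDl.
  rewrite mulrC -ler_pdivlMr ?ltr_wpDl//.
  near: h; apply: nbhs0_le; rewrite divr_gt0// ltr_wpDl//.
have dE := diff_unique dfc ho.
split=> //; apply/diff_locallyP; rewrite dE; split=> //.
Unshelve. all: by end_near. Qed.

(** * The inverse of the Sylvester operator of a symmetric matrix *)

Definition sylvester_weights (R : realType) n (sigma : 'rV[R]_n) : 'M[R]_n :=
  \matrix_(i < n, j < n)
    (if 0 < sigma 0 i + sigma 0 j then (sigma 0 i + sigma 0 j)^-1 else 0).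

(** When the eigenvalues [sigma] of [H = V diag(sigma) V^T] are positive, this
    is the solution [Y] of [H Y + Y H = B]. *)
Definition sylvester (R : realType) n (V : 'M[R]_n) (sigma : 'rV[R]_n)
    (B : 'M[R]_n) : 'M[R]_n :=
  V *m hadamard (sylvester_weights sigma) (V^T *m B *m V) *m V^T.

Lemma sylvester_is_linear (R : realType) n (V : 'M[R]_n) (sigma : 'rV[R]_n) :
  linear (sylvester V sigma).
Proof.
move=> a A B; rewrite /sylvester.
have -> : hadamard (sylvester_weights sigma) (V^T *m (a *: A + B) *m V) =
    a *: hadamard (sylvester_weights sigma) (V^T *m A *m V) +
    hadamard (sylvester_weights sigma) (V^T *m B *m V).
  rewrite mulmxDr mulmxDl -scalemxAr -scalemxAl.
  by apply/matrixP => i j; rewrite !mxE mulrDr mulrCA.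
by rewrite mulmxDr mulmxDl -scalemxAr -scalemxAl.
Qed.

HB.instance Definition _ (R : realType) n (V : 'M[R]_n) (sigma : 'rV[R]_n) :=
  GRing.isLinear.Build R 'M[R]_n 'M[R]_n *:%R (sylvester V sigma)
    (sylvester_is_linear V sigma).

(** The weights form a symmetric matrix, so transposition can be moved through
    the entrywise product. *)
Lemma sylvester_tr (R : realType) n (V : 'M[R]_n) (sigma : 'rV[R]_n) B :
  (sylvester V sigma B)^T = sylvester V sigma B^T.
Proof.
rewrite /sylvester !trmx_mul trmxK mulmxA; congr (_ *m _ *m _).
have -> : V^T *m B^T *m V = (V^T *m B *m V)^T.
  by rewrite !trmx_mul trmxK mulmxA.
by apply/matrixP => i j; rewrite !mxE [sigma 0 j + _]addrC.
Qed.

Section Spectral.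
Context {R : realType} {n : nat} {H V : 'M[R]_n} {sigma : 'rV[R]_n}.
Hypothesis hV : V^T *m V = 1%:M.
Hypothesis hH : H = V *m diag_mx sigma *m V^T.

(** The quadratic form is diagonal in the coordinates [V^T x]. *)
Lemma spectral_quad (x : 'cV[R]_n) :
  (x^T *m H *m x) 0 0 = \sum_i sigma 0 i * ((V^T *m x) i 0) ^+ 2.
Proof.
rewrite hH; set y := V^T *m x.
have -> : x^T *m (V *m diag_mx sigma *m V^T) *m x = y^T *m (diag_mx sigma *m y).
  by rewrite /y trmx_mul trmxK !mulmxA.
rewrite mxE; apply: eq_bigr => i _.
by rewrite mul_diag_mx !mxE expr2 mulrCA.
Qed.

Lemma spectral_coercive (c : R) : (forall i, c <= sigma 0 i) ->
  forall x : 'cV[R]_n, c * (x^T *m x) 0 0 <= (x^T *m H *m x) 0 0.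
Proof.
move=> cs x; rewrite spectral_quad.
have -> : x^T *m x = (V^T *m x)^T *m (V^T *m x).
  by rewrite trmx_mul trmxK mulmxA -(mulmxA x^T) (mulmx1C hV) mulmx1.
rewrite mxE mulr_sumr ler_sum// => i _.
by rewrite [X in _ * (X * _)]mxE -expr2 ler_wpM2r// sqr_ge0.
Qed.

Lemma spectral_ge0 : psdmx H -> forall i, 0 <= sigma 0 i.
Proof.
move=> [_ psd] i; have := psd (V *m delta_mx i 0).
rewrite spectral_quad mulmxA hV mul1mx (bigD1 i)//= mxE !eqxx expr1n mulr1.
rewrite big1 ?addr0// => j ji.
by rewrite mxE (negbTE ji) expr0n mulr0.
Qed.

Lemma spectral_gt0 : psdmx H -> H \in unitmx -> forall i, 0 < sigma 0 i.
Proof.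
move=> psd Hu i; rewrite lt_neqAle eq_sym spectral_ge0// andbT.
have : diag_mx sigma \in unitmx.
  move: Hu; rewrite hH !unitmx_mul => /andP[/andP[_ ->//]].
by rewrite unitmxE det_diag unitfE => /prodf_neq0/(_ i isT).
Qed.

Lemma spectral_sym : H^T = H.
Proof. by rewrite hH !trmx_mul trmxK tr_diag_mx mulmxA. Qed.

Hypothesis sigma_gt0 : forall i, 0 < sigma 0 i.

Lemma sylvester_weightsE i j :
  sylvester_weights sigma i j = (sigma 0 i + sigma 0 j)^-1.
Proof. by rewrite mxE addr_gt0. Qed.

(** In the eigenbasis [Y |-> H Y + Y H] multiplies the entry [(i, j)] by
    [sigma_i + sigma_j], which is nonzero. *)
Lemma sylvesterK B : H *m sylvester V sigma B + sylvester V sigma B *m H = B.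
Proof.
rewrite /sylvester; set Y := hadamard _ _.
have -> : H *m (V *m Y *m V^T) + (V *m Y *m V^T) *m H =
    V *m (diag_mx sigma *m Y + Y *m diag_mx sigma) *m V^T.
  rewrite hH mulmxDr mulmxDl !mulmxA; congr (_ + _).
    by rewrite -[_ *m V^T *m V]mulmxA hV mulmx1.
  by rewrite -[_ *m V^T *m V]mulmxA hV mulmx1.
have -> : diag_mx sigma *m Y + Y *m diag_mx sigma = V^T *m B *m V.
  apply/matrixP => i j; rewrite mxE mul_diag_mx mul_mx_diag.
  rewrite !(mxE, sylvester_weightsE) [X in _ + X]mulrC -mulrDl mulrA.
  by rewrite addr_gt0// divff ?mul1r// gt_eqF// addr_gt0.
by rewrite !mulmxA (mulmx1C hV) mul1mx -mulmxA (mulmx1C hV) mulmx1.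
Qed.

Lemma sylvester_unique E : sylvester V sigma (H *m E + E *m H) = E.
Proof.
rewrite /sylvester.
have -> : V^T *m (H *m E + E *m H) *m V =
    diag_mx sigma *m (V^T *m E *m V) + (V^T *m E *m V) *m diag_mx sigma.
  rewrite hH mulmxDr mulmxDl !mulmxA hV mul1mx; congr (_ + _).
  by rewrite -[_ *m V^T *m V]mulmxA hV mulmx1.
set F := V^T *m E *m V.
have -> : hadamard (sylvester_weights sigma)
    (diag_mx sigma *m F + F *m diag_mx sigma) = F.
  move: F => F; apply/matrixP => i j; rewrite mul_diag_mx mul_mx_diag.
  rewrite mxE sylvester_weightsE !mxE.
  by rewrite [F i j * _]mulrC -mulrDl mulKf// gt_eqF// addr_gt0.
by rewrite !mulmxA (mulmx1C hV) mul1mx -mulmxA (mulmx1C hV) mulmx1.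
Qed.

(** The Sylvester operator is self-adjoint because [H] is symmetric; hence so is
    its inverse. *)
Lemma sylvester_selfadjoint A B :
  frobenius (sylvester V sigma A) B = frobenius A (sylvester V sigma B).
Proof.
have sym (P Q : 'M[R]_n) :
    \tr (P^T *m (H *m Q + Q *m H)) = \tr ((H *m P + P *m H)^T *m Q).
  rewrite mulmxDr mxtraceD raddfD/= mulmxDl mxtraceD.
  rewrite !trmx_mul spectral_sym !mulmxA; congr (_ + _).
  by rewrite mxtrace_mulC mulmxA.
by rewrite -[B in LHS]sylvesterK /frobenius sym sylvesterK.
Qed.

End Spectral.

(** * Perturbation of the positive square root *)

Lemma quad_self_sum (R : realType) n (x : 'cV[R]_n) :
  (x^T *m x) 0 0 = \sum_i x i 0 ^+ 2.
Proof. by rewrite mxE; apply: eq_bigr => i _; rewrite mxE expr2. Qed.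

(** A vector in the kernel of [H] makes the quadratic form vanish. *)
Lemma posdef_unitmx (R : realType) n (H : 'M[R]_n) (c : R) : 0 < c ->
  (forall x : 'cV[R]_n, c * (x^T *m x) 0 0 <= (x^T *m H *m x) 0 0) ->
  H \in unitmx.
Proof.
move=> c0 Hc; rewrite -row_free_unit; apply/inj_row_free => v vH0.
have := Hc v^T; rewrite quad_self_sum trmxK vH0 mul0mx [leRHS]mxE pmulr_rle0//.
move=> vv; apply/rowP => j; rewrite mxE; apply/eqP; rewrite -sqrf_eq0.
have /psumr_eq0P : \sum_i v^T i 0 ^+ 2 = 0.
  by apply/eqP; rewrite eq_le vv sumr_ge0// => i _; exact: sqr_ge0.
by move=> /(_ (fun i _ => sqr_ge0 _) j isT); rewrite mxE => ->.
Qed.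

(** Reads the trace column by column, so that bounds on the quadratic form of
    [H] apply to it. *)
Lemma trace_quad (R : realType) n p (E : 'M[R]_(n, p)) (H : 'M[R]_n) :
  \tr (E^T *m H *m E) = \sum_j ((col j E)^T *m H *m col j E) 0 0.
Proof.
apply: eq_bigr => j _.
have -> : (col j E)^T *m H *m col j E = row j (E^T *m H *m E) *m delta_mx j 0.
  by rewrite tr_col colE !row_mul -!mulmxA.
by rewrite -colE !mxE.
Qed.

(** Carries Frobenius estimates, natural for quadratic forms, to the sup norm
    that defines the topology of matrices. *)
Lemma sqr_mx_norm_le (R : realType) m n (E : 'M[R]_(m, n)) :
  `|E| ^+ 2 <= \tr (E^T *m E).
Proof.
have trE : \tr (E^T *m E) = \sum_j \sum_i E i j ^+ 2.
  apply: eq_bigr => j _; rewrite mxE; apply: eq_bigr => i _.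
  by rewrite mxE expr2.
have tr0 : 0 <= \tr (E^T *m E).
  by rewrite trE; do 2 (apply: sumr_ge0 => ? _); exact: sqr_ge0.
rewrite -(@ler_sqrt _ _ _ tr0) sqrtr_sqr ger0_norm//.
apply: mx_norm_le => [|i j]; first exact: sqrtr_ge0.
rewrite -sqrtr_sqr ler_sqrt// trE (bigD1 j)//= (bigD1 i)//= -addrA lerDl.
rewrite addr_ge0//; first by apply: sumr_ge0 => ? _; exact: sqr_ge0.
by do 2 (apply: sumr_ge0 => ? _); exact: sqr_ge0.
Qed.

Lemma frobenius_le (R : realType) m n (A B : 'M[R]_(m, n)) :
  frobenius A B <= (n * m)%:R * (`|A| * `|B|).
Proof.
rewrite /frobenius (le_trans (ler_norm _))//.
rewrite (le_trans (ler_norm_sum _ _ _))//.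
have /le_trans -> // : \sum_j `|(A^T *m B) j j| <=
    \sum_(j < n) m%:R * `|A| * `|B|.
  apply: ler_sum => j _.
  by rewrite -(trmx_norm A) (le_trans (mx_norm_entry _ _ _))// mulmx_norm.
by rewrite sumr_const card_ord -[leLHS]mulr_natl natrM !mulrA lexx.
Qed.

(** The difference [E] of the two roots satisfies [D = H E + E H'] with
    [D = H'^2 - H^2], so [<E, D>] is a sum of two values of quadratic forms: the
    one of [H] dominates [c |E|^2] and the one of [H'] is nonnegative.  The
    bound is global in [H'], so it applies to whichever root is chosen. *)
Lemma psd_sqrt_lipschitz (R : realType) n (H H' : 'M[R]_n) (c : R) :
  H^T = H ->
  (forall x : 'cV[R]_n, c * (x^T *m x) 0 0 <= (x^T *m H *m x) 0 0) ->
  psdmx H' ->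
  c * `|H' - H| <= (n * n)%:R * `|H' *m H' - H *m H|.
Proof.
move=> Hs Hc [Hs' H'0]; set E := H' - H; set D := H' *m H' - H *m H.
have [->|E0] := eqVneq E 0; first by rewrite normr0 mulr0 !mulr_ge0.
have Es : E^T = E by rewrite /E linearB/= Hs Hs'.
have [c0|c0] := leP c 0.
  by rewrite (@le_trans _ _ 0)// mulr_le0_ge0.
rewrite -(@ler_pM2r _ `|E|) ?normr_gt0// -mulrA -expr2.
rewrite -[leRHS]mulrA [_ * `|E|]mulrC.
apply: le_trans (frobenius_le E D).
have -> : frobenius E D = \tr (E^T *m H *m E) + \tr (E^T *m H' *m E).
  rewrite /frobenius.
  have -> : D = H *m E + E *m H'.
    by rewrite /D /E mulmxBr mulmxBl [RHS]addrC -addrA addKr addrC.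
  rewrite mulmxDr mxtraceD !mulmxA; congr (_ + _).
  by rewrite [RHS]mxtrace_mulC mulmxA !Es.
rewrite (@le_trans _ _ (c * \tr (E^T *m E)))//.
  by rewrite ler_wpM2l ?sqr_mx_norm_le// ltW.
rewrite -{1}[E^T]mulmx1 !trace_quad ler_wpDr//.
  by apply: sumr_ge0 => j _; exact: H'0.
by rewrite mulr_sumr ler_sum// => j _; rewrite mulmx1.
Qed.

(** The quadratic form of [E] is [<x, E x>], at most [n^2 |E|] times
    [|x|^2] in sup norm, hence in Euclidean norm. *)
Lemma posdef_near (R : realType) n (H E : 'M[R]_n) (c : R) :
  (forall x : 'cV[R]_n, c * (x^T *m x) 0 0 <= (x^T *m H *m x) 0 0) ->
  forall x : 'cV[R]_n, (c - (n * n)%:R * `|E|) * (x^T *m x) 0 0 <=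
    (x^T *m (H + E) *m x) 0 0.
Proof.
move=> Hc x.
have trE (A : 'M[R]_1) : \tr A = A 0 0 by rewrite /mxtrace big_ord1.
have qE : - (x^T *m E *m x) 0 0 <= (n * n)%:R * `|E| * (x^T *m x) 0 0.
  have -> : - (x^T *m E *m x) 0 0 = frobenius x (- E *m x).
    by rewrite /frobenius trE mulNmx mulmxN mulmxA [RHS]mxE.
  rewrite (le_trans (frobenius_le _ _))// mul1n natrM -!mulrA ler_wpM2l//.
  rewrite (@le_trans _ _ (`|x| * (n%:R * `|E| * `|x|)))//.
    by rewrite ler_wpM2l// -(normrN E) mulmx_norm.
  have -> : `|x| * (n%:R * `|E| * `|x|) = n%:R * (`|E| * `|x| ^+ 2) by ring.
  by rewrite ler_wpM2l// ler_wpM2l// -trE sqr_mx_norm_le.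
have -> : (x^T *m (H + E) *m x) 0 0 =
    (x^T *m H *m x) 0 0 + (x^T *m E *m x) 0 0.
  by rewrite mulmxDr mulmxDl [LHS]mxE.
have := Hc x; lra.
Qed.

(** Joins the complete uniform structure of matrices with their normed module
    structure. *)
Definition complete_mx (R : realType) m n : completeNormedModType R :=
  HB.pack_for (completeNormedModType R) 'M[R]_(m, n).

(** The contraction principle on a closed ball centred at 0. *)
Lemma mx_ball_fixed_point (R : realType) m n (f : 'M[R]_(m, n) -> 'M[R]_(m, n))
    (r : R) : 0 <= r ->
  (forall A, `|A| <= r -> `|f A| <= r) ->
  (forall A B, `|A| <= r -> `|B| <= r -> `|f A - f B| <= 2^-1 * `|A - B|) ->
  exists2 A, `|A| <= r & A = f A.
Proof.
move=> r0 fr fc.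
pose U : set (complete_mx R m n) := [set A | `|A| <= r]%classic.
have fU : set_fun U U f by move=> A; exact: fr.
pose f' : {fun U >-> U} := mkfun_fun fU.
have half0 : 0 <= 2^-1 :> R by rewrite invr_ge0.
have ctr : @is_contraction R (complete_mx R m n) (complete_mx R m n) U U f'.
  exists (NngNum half0); split; first by rewrite /= invf_lt1 ?ltr1n.
  by move=> [A B] [/= UA UB]; exact: fc.

have clU : closed U.
  by apply: preimage_closed (@closed_le _ r) => x _; exact: norm_continuous.
have U0 : (U !=set0)%classic by exists 0; rewrite /U /= normr0.
by have [A UA Af] := banach_fixed_point ctr clU U0; exists A.
Qed.

Lemma small_scale (R : realType) (a e : R) : 0 <= a -> 0 < e ->
  exists2 r : R, 0 < r & forall s, s <= r -> a * s <= e.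
Proof.
move=> a0 e0; exists (e / (a + 1)) => [|s sr].
  by rewrite divr_gt0// ltr_wpDl.
rewrite (le_trans (ler_wpM2l a0 sr))// mulrCA ger_pMr// ler_pdivrMr ?ltr_wpDl//.
by rewrite mul1r lerDl.
Qed.

Section LocalSquareRoot.
Context {R : realType} {n : nat} {H V : 'M[R]_n} {sigma : 'rV[R]_n}.
Hypothesis hV : V^T *m V = 1%:M.
Hypothesis hH : H = V *m diag_mx sigma *m V^T.
Hypothesis sigma_gt0 : forall i, 0 < sigma 0 i.

Lemma spectral_posdef : exists2 c : R, 0 < c &
  forall x : 'cV[R]_n, c * (x^T *m x) 0 0 <= (x^T *m H *m x) 0 0.
Proof.
exists (\big[Num.min/1]_i sigma 0 i).
  by apply: (big_ind (fun x => 0 < x)) => // a b a0 b0; rewrite lt_min a0.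
by apply: (spectral_coercive hV hH) => i; exact: bigmin_le.
Qed.

(** The equation [(H + E)^2 = H^2 + D] is the fixed point equation
    [E = S (D - E^2)], and its right-hand side contracts a small ball. *)
Lemma psd_sqrt_near : exists2 d : R, 0 < d & forall D : 'M[R]_n,
  D^T = D -> `|D| <= d ->
  exists H', [/\ psdmx H', H' \in unitmx & H' *m H' = H *m H + D].
Proof.
have [c c0 Hc] := spectral_posdef.
have [k k0 kS] := linear_mx_bounded (sylvester V sigma).
have kn0 : 0 <= k * n%:R by rewrite mulr_ge0 // ltW.
have c20 : 0 < c / 2 by rewrite divr_gt0.
have q0 : 0 < 4^-1 :> R by rewrite invr_gt0.
(* The bound on [r1] gives the contraction factor 1/2; the one on [r2] keeps the
   quadratic form of [H + E] above [c / 2]. *)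
have [r1 r10 hr1] := small_scale kn0 q0.
have [r2 r20 hr2] := small_scale (ler0n R (n * n)) c20.
pose r := Num.min r1 r2.
have r0 : 0 < r by rewrite lt_min r10.
have {}hr1 : k * n%:R * r <= 4^-1 by apply: hr1; rewrite ge_min lexx.
have {}hr2 : (n * n)%:R * r <= c / 2 by apply: hr2; rewrite ge_min lexx orbT.
exists (r / (2 * k)) => [|D Ds Dd]; first by rewrite divr_gt0// mulr_gt0.
pose f E := sylvester V sigma (D - E *m E).
have fr E : `|E| <= r -> `|f E| <= r.
  move=> Er; rewrite (le_trans (kS _))//.
  have EE : `|E *m E| <= n%:R * r * r.
    by rewrite (le_trans (mulmx_norm _ _))// ler_pM ?mulr_ge0// ler_wpM2l.
  have : `|D - E *m E| <= r / (2 * k) + n%:R * r * r.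
    by rewrite (le_trans (ler_normB _ _))// lerD.
  move=> /(ler_wpM2l (ltW k0))/le_trans -> //.
  have -> : k * (r / (2 * k) + n%:R * r * r) = r / 2 + k * n%:R * r * r.
    by field; rewrite gt_eqF.
  have := ler_wpM2r (ltW r0) hr1; lra.
have fc E F : `|E| <= r -> `|F| <= r -> `|f E - f F| <= 2^-1 * `|E - F|.
  move=> Er Fr; rewrite -[f E - f F]linearB/= (le_trans (kS _))//.
  have -> : D - E *m E - (D - F *m F) = F *m (F - E) + (F - E) *m E.
    by rewrite mulmxBr mulmxBl subrKA opprB addrC subrKA.
  have h1 : `|F *m (F - E)| <= n%:R * r * `|E - F|.
    by rewrite (le_trans (mulmx_norm _ _))// distrC ler_wpM2r// ler_wpM2l.
  have h2 : `|(F - E) *m E| <= n%:R * r * `|E - F|.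
    rewrite (le_trans (mulmx_norm _ _))// distrC mulrAC ler_wpM2r//.
    by rewrite ler_wpM2l.
  have := le_trans (ler_normD _ _) (lerD h1 h2).
  move=> /(ler_wpM2l (ltW k0))/le_trans -> //.
  have := ler_wpM2r (normr_ge0 (E - F)) hr1; lra.
have [E Er Ef] := mx_ball_fixed_point (ltW r0) fr fc.
(* [E^T] is a fixed point in the same ball, so it is [E]. *)
have Es : E^T = E.
  have EtE : E^T = f E^T.
    by rewrite {1}Ef /f sylvester_tr linearB/= trmx_mul Ds.
  have := fc _ _ (_ : `|E^T| <= r) Er; rewrite trmx_norm -Ef -EtE => /(_ Er) h.
  apply/eqP; rewrite -subr_eq0 -normr_le0.
  by move: h; have := normr_ge0 (E^T - E); lra.
have hD : H *m E + E *m H = D - E *m E.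
  by rewrite {1 2}Ef /f (sylvesterK hV hH).
have Hs := spectral_sym hH.
have posH' (x : 'cV[R]_n) : c / 2 * (x^T *m x) 0 0 <= (x^T *m (H + E) *m x) 0 0.
  apply: le_trans (posdef_near E Hc x); rewrite ler_wpM2r//.
    by rewrite quad_self_sum sumr_ge0// => i _; exact: sqr_ge0.
  have : (n * n)%:R * `|E| <= c / 2 by apply: le_trans hr2; rewrite ler_wpM2l.
  lra.
exists (H + E); split.
- split=> [|x]; first by rewrite linearD/= Hs Es.
  apply: le_trans (posH' x); rewrite mulr_ge0 ?(ltW c20)// quad_self_sum.
  by rewrite sumr_ge0// => i _; exact: sqr_ge0.
- exact: posdef_unitmx c20 posH'.
- rewrite mulmxDr !mulmxDl addrACA -!addrA; congr (_ + _).
  by rewrite addrA hD subrK.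
Qed.

End LocalSquareRoot.

(** The columns of [W] are unit vectors. *)
Lemma isometry_norm_le1 (R : realType) m n (W : 'M[R]_(m, n)) :
  W^T *m W = 1%:M -> `|W| <= 1.
Proof.
move=> hW; apply: mx_norm_le => // i j.
have : (W^T *m W) j j = 1 by rewrite hW mxE eqxx.
rewrite mxE (bigD1 i)//= mxE -expr2 => h.
rewrite -(@expr_le1 _ 2)// real_normK ?num_real// -h lerDl sumr_ge0// => k _.
by rewrite mxE -expr2 sqr_ge0.
Qed.

(** * Differential of the polar factors *)

Lemma polar_gram (R : realType) m n (M W : 'M[R]_(m, n)) (H : 'M[R]_n) :
  is_polar M W H -> M^T *m M = H *m H.
Proof.
move=> [-> hW [Hs _]].
by rewrite trmx_mul Hs mulmxA -[X in X *m H]mulmxA hW mulmx1.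
Qed.

(** An invertible positive square root [H] of the Gram matrix determines the
    isometric factor as [M H^-1]. *)
Lemma gram_polar (R : realType) m n (M : 'M[R]_(m, n)) (H : 'M[R]_n) :
  psdmx H -> H \in unitmx -> H *m H = M^T *m M ->
  is_polar M (M *m invmx H) H.
Proof.
move=> psdH Hu HH; split=> //; first by rewrite mulmxKV.
rewrite trmx_mul trmx_inv psdH.1 mulmxA -[_ *m M^T *m M]mulmxA -HH.
by rewrite mulKmx// mulmxV.
Qed.

Lemma polar_rank_unitmx (R : realType) m n (M W : 'M[R]_(m, n)) (H : 'M[R]_n) :
  \rank M = n -> is_polar M W H -> H \in unitmx.
Proof.
move=> rM [MWH _ _]; rewrite -row_full_unit /row_full eqn_leq rank_leq_col.
by rewrite -{1}rM MWH mxrankM_maxr.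
Qed.

(** The differential of the Gram matrix [M^T M] in the direction [h]. *)
Definition dgram (R : realType) m n (M h : 'M[R]_(m, n)) : 'M[R]_n :=
  M^T *m h + h^T *m M.

(** Obtained by differentiating [H^2 = M^T M]. *)
Definition dpolar_H (R : realType) m n (M : 'M[R]_(m, n)) (V : 'M[R]_n)
    (sigma : 'rV[R]_n) (h : 'M[R]_(m, n)) : 'M[R]_n :=
  sylvester V sigma (dgram M h).

(** Obtained by differentiating [W H = M]. *)
Definition dpolar_W (R : realType) m n (M W : 'M[R]_(m, n)) (H V : 'M[R]_n)
    (sigma : 'rV[R]_n) (h : 'M[R]_(m, n)) : 'M[R]_(m, n) :=
  (h - W *m dpolar_H M V sigma h) *m invmx H.

Definition dpolar (R : realType) m n (M W : 'M[R]_(m, n)) (H V : 'M[R]_n)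
    (sigma : 'rV[R]_n) (h : 'M[R]_(m, n)) : 'M[R]_(m, n) * 'M[R]_n :=
  (dpolar_W M W H V sigma h, dpolar_H M V sigma h).

Lemma dpolar_is_linear (R : realType) m n (M W : 'M[R]_(m, n)) (H V : 'M[R]_n)
    (sigma : 'rV[R]_n) : linear (dpolar M W H V sigma).
Proof.
have linH a h k : dpolar_H M V sigma (a *: h + k) =
    a *: dpolar_H M V sigma h + dpolar_H M V sigma k.
  rewrite -linearP; congr sylvester; rewrite /dgram [(a *: h + k)^T]linearP/=.
  by rewrite mulmxDr mulmxDl -scalemxAr -scalemxAl scalerDr addrACA.
have linW a h k : dpolar_W M W H V sigma (a *: h + k) =
    a *: dpolar_W M W H V sigma h + dpolar_W M W H V sigma k.
  rewrite /dpolar_W linH [in RHS]scalemxAl -[in RHS]mulmxDl mulmxDr -scalemxAr.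
  by congr (_ *m _); rewrite scalerBr opprD addrACA.
by move=> a h k; rewrite /dpolar linH linW.
Qed.

HB.instance Definition _ (R : realType) m n (M W : 'M[R]_(m, n))
    (H V : 'M[R]_n) (sigma : 'rV[R]_n) :=
  GRing.isLinear.Build R 'M[R]_(m, n) ('M[R]_(m, n) * 'M[R]_n)%type *:%R
    (dpolar M W H V sigma) (dpolar_is_linear M W H V sigma).

Section PolarDifferential.
Context {R : realType} {m n : nat} {M W : 'M[R]_(m, n)}.
Context {H V : 'M[R]_n} {sigma : 'rV[R]_n}.
Hypothesis hWH : is_polar M W H.
Hypothesis hV : V^T *m V = 1%:M.
Hypothesis hH : H = V *m diag_mx sigma *m V^T.
Hypothesis sigma_gt0 : forall i, 0 < sigma 0 i.

Lemma gram_shift h :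
  (h + M)^T *m (h + M) = H *m H + (dgram M h + h^T *m h).
Proof.
rewrite -(polar_gram hWH) /dgram [(h + M)^T]linearD/= mulmxDr !mulmxDl.
by rewrite [LHS](AC (2*2) (4*((2*3)*1)))/=.
Qed.

Lemma gram_increment_le : exists2 k : R, 0 <= k & forall h, `|h| <= 1 ->
  `|dgram M h + h^T *m h| <= k * `|h|.
Proof.
exists (m%:R * (2 * `|M| + 1)) => [|h h1].
  by rewrite mulr_ge0// addr_ge0// mulr_ge0.
have n1 : `|M^T *m h| <= m%:R * `|M| * `|h|.
  by rewrite -(trmx_norm M) mulmx_norm.
have n2 : `|h^T *m M| <= m%:R * `|M| * `|h|.
  by rewrite mulrAC -(trmx_norm h) mulmx_norm.
have n3 : `|h^T *m h| <= m%:R * `|h|.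
  rewrite (le_trans (mulmx_norm _ _))// trmx_norm -mulrA ler_wpM2l//.
  by rewrite ler_piMl.
rewrite (le_trans (ler_normD _ _))//.
have := ler_normD (M^T *m h) (h^T *m M); rewrite -/(dgram M h); lra.
Qed.

Lemma polar_near : exists2 d : R, 0 < d & forall h, `|h| <= d ->
  exists WH, is_polar (h + M) WH.1 WH.2.
Proof.
have [d d0 hd] := psd_sqrt_near hV hH sigma_gt0.
have [k k0 hk] := gram_increment_le.
have [r r0 hr] := small_scale k0 d0.
exists (Num.min 1 r) => [|h]; first by rewrite lt_min ltr01.
rewrite le_min => /andP[h1 hr'].
have [||H' [psdH' uH' HH']] := hd (dgram M h + h^T *m h).
- by rewrite /dgram !linearD/= !trmx_mul !trmxK [X in X + _]addrC.
- by rewrite (le_trans (hk h h1))// hr.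
- exists ((h + M) *m invmx H', H') => /=.
  by apply: gram_polar; rewrite // gram_shift.
Qed.

Lemma polar_H_lipschitz : exists2 k : R, 0 <= k & forall h W' H', `|h| <= 1 ->
  is_polar (h + M) W' H' -> `|H' - H| <= k * `|h|.
Proof.
have [k k0 hk] := gram_increment_le.
have [c c0 Hc] := spectral_posdef hV hH sigma_gt0.
exists (c^-1 * ((n * n)%:R * k)) => [|h W' H' h1 hp].
  by rewrite !mulr_ge0// invr_ge0 ltW.
rewrite -!mulrA ler_pdivlMl//.
have [_ _ psdH'] := hp.
apply: le_trans (psd_sqrt_lipschitz (spectral_sym hH) Hc psdH') _.
by rewrite ler_wpM2l// -(polar_gram hp) gram_shift addrC addKr hk.
Qed.

(** The symmetric factor changes by [S (D - E^2)] with [E = O(h)], and the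
    linear part of [D] is [dgram M h]. *)
Lemma polar_H_expansion : exists2 k : R, 0 <= k & forall h W' H', `|h| <= 1 ->
  is_polar (h + M) W' H' -> `|H' - H - dpolar_H M V sigma h| <= k * `|h| ^+ 2.
Proof.
have [k k0 hk] := polar_H_lipschitz.
have [s s0 hs] := linear_mx_bounded (sylvester V sigma).
exists (s * (m%:R + n%:R * k ^+ 2)) => [|h W' H' h1 hp].
  by rewrite mulr_ge0 ?(ltW s0)// addr_ge0// mulr_ge0// sqr_ge0.
have Ek := hk _ _ _ h1 hp; set E := H' - H in Ek *.
have H'E : H' = H + E by rewrite /E addrC subrK.
clearbody E.
have e : H *m E + E *m H + E *m E = dgram M h + h^T *m h.
  apply: (addrI (H *m H)); rewrite -gram_shift (polar_gram hp) H'E.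
  by rewrite mulmxDl !mulmxDr !addrA.
have -> : E - dpolar_H M V sigma h = sylvester V sigma (h^T *m h - E *m E).
  rewrite -{1}(sylvester_unique hV hH sigma_gt0 E) /dpolar_H -linearB/=.
  congr sylvester; apply/eqP.
  by rewrite subr_eq addrAC [_ + dgram M h]addrC -e addrK.
rewrite (le_trans (hs _))// -mulrA ler_wpM2l ?(ltW s0)//.
rewrite (le_trans (ler_normB _ _))// mulrDl lerD//.
  by rewrite (le_trans (mulmx_norm _ _))// trmx_norm expr2 mulrA.
rewrite (le_trans (mulmx_norm _ _))// -!mulrA ler_wpM2l//.
have -> : k * (k * `|h| ^+ 2) = (k * `|h|) * (k * `|h|) by ring.
by rewrite ler_pM.
Qed.

Hypothesis Hu : H \in unitmx.

(** From [W' H' = M + h] and [W H = M] follows [F = (h - W' E) H^-1] for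
    [F = W' - W], so [F = O(h)]; replacing [W' E] by [W dH] then costs
    [F E + W (E - dH)], which is of second order. *)
Lemma polar_W_expansion : exists2 k : R, 0 <= k & forall h W' H', `|h| <= 1 ->
  is_polar (h + M) W' H' ->
  `|W' - W - dpolar_W M W H V sigma h| <= k * `|h| ^+ 2.
Proof.
have [kE kE0 hkE] := polar_H_lipschitz.
have [kH kH0 hkH] := polar_H_expansion.
have [s s0 hs] :=
  linear_mx_bounded (mulmxr (invmx H) : 'M[R]_(m, n) -> 'M[R]_(m, n)).
have [MWH WW _] := hWH; have W1 := isometry_norm_le1 WW.
pose kF := s * (1 + n%:R * kE).
have kF0 : 0 <= kF by rewrite mulr_ge0 ?(ltW s0)// addr_ge0// mulr_ge0.
exists (s * (n%:R * (kF * kE) + n%:R * kH)) => [|h W' H' h1 hp].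
  by rewrite mulr_ge0 ?(ltW s0)// addr_ge0// mulr_ge0// mulr_ge0.
have Ek := hkE _ _ _ h1 hp; have EH := hkH _ _ _ h1 hp.
have [hMWH' WW' _] := hp; have W'1 := isometry_norm_le1 WW'.
set E := H' - H in Ek EH *; set F := W' - W.
have FE : F = (h - W' *m E) *m invmx H.
  rewrite -[LHS](mulmxK Hu) /F /E mulmxBr -hMWH' mulmxBl -MWH; congr (_ *m _).
  by rewrite opprB addrCA opprD addNKr.
have Fk : `|F| <= kF * `|h|.
  rewrite FE (le_trans (hs _))// /kF -mulrA ler_wpM2l ?(ltW s0)//.
  rewrite (le_trans (ler_normB _ _))// mulrDl mul1r lerD//.
  rewrite (le_trans (mulmx_norm _ _))// -!mulrA ler_wpM2l//.
  by rewrite -[leRHS]mul1r ler_pM.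
clearbody kF.
have -> : F - dpolar_W M W H V sigma h =
    - (F *m E + W *m (E - dpolar_H M V sigma h)) *m invmx H.
  rewrite [X in X - _]FE /dpolar_W -mulmxBl; congr (_ *m _).
  rewrite [F *m E]mulmxBl [W *m (E - _)]mulmxBr subrKA !opprB addrC.
  by rewrite subrKA.
rewrite (le_trans (hs _))// normrN -mulrA ler_wpM2l ?(ltW s0)//.
rewrite (le_trans (ler_normD _ _))// mulrDl lerD//.
  rewrite (le_trans (mulmx_norm _ _))// -!mulrA ler_wpM2l// expr2.
  have -> : kF * (kE * (`|h| * `|h|)) = (kF * `|h|) * (kE * `|h|) by ring.
  by rewrite ler_pM.
rewrite (le_trans (mulmx_norm _ _))// -!mulrA ler_wpM2l//.
by rewrite -[leRHS]mul1r ler_pM.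
Qed.

(** The expansions hold for every polar decomposition of [h + M]; at [h = 0]
    they force the chosen one to be [(W, H)]. *)
Lemma polar_factors_full_rank : polar_factors M = (W, H).
Proof.
have [kH kH0 hkH] := polar_H_expansion.
have [kW kW0 hkW] := polar_W_expansion.
have : is_polar (0 + M) (polar_factors M).1 (polar_factors M).2.
  rewrite add0r; apply: (@getPex _ [set WH | is_polar M WH.1 WH.2]%classic).
  by exists (W, H).
case: polar_factors => W' H' /= hp.
have d0E : dpolar M W H V sigma 0 = 0 by rewrite linear0.
have h01 : `|0 : 'M[R]_(m, n)| <= 1 by rewrite normr0.
have := hkW _ _ _ h01 hp; have := hkH _ _ _ h01 hp.
move: d0E; rewrite /dpolar => -[-> ->].
rewrite !subr0 normr0 expr0n !mulr0 !normr_le0 !subr_eq0.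
by move=> /eqP -> /eqP ->.
Qed.

Lemma polar_factors_diff : differentiable (@polar_factors R m n) M /\
  'd (@polar_factors R m n) M = dpolar M W H V sigma
    :> ('M[R]_(m, n) -> 'M[R]_(m, n) * 'M[R]_n).
Proof.
have [d d0 hd] := polar_near.
have [kH kH0 hkH] := polar_H_expansion.
have [kW kW0 hkW] := polar_W_expansion.
apply: (@quadratic_remainder_diff _ _ _ _ _ _ (kW + kH)).
  exact: linear_mx_continuous.
have dmin : 0 < Num.min 1 d by rewrite lt_min ltr01.
have := @nbhs0_le R 'M[R]_(m, n) _ dmin.
apply: filterS => h /=.
rewrite le_min => /andP[h1 hd'].
have := getPex (hd _ hd').
rewrite polar_factors_full_rank -/(polar_factors (h + M)).
case: polar_factors => W' H' /= hp.
have hW := hkW _ _ _ h1 hp; have hH' := hkH _ _ _ h1 hp.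
rewrite prod_normE /= ge_max mulrDl !opprD !addrA.
by rewrite (le_trans hW) ?(le_trans hH') ?lerDl ?lerDr// mulr_ge0// sqr_ge0.
Qed.

End PolarDifferential.

(** * Frobenius pairing and the chain rule *)

Lemma frobeniusDl (R : realType) m n (A B C : 'M[R]_(m, n)) :
  frobenius (A + B) C = frobenius A C + frobenius B C.
Proof. by rewrite /frobenius linearD mulmxDl mxtraceD. Qed.

Lemma frobeniusDr (R : realType) m n (A B C : 'M[R]_(m, n)) :
  frobenius A (B + C) = frobenius A B + frobenius A C.
Proof. by rewrite /frobenius mulmxDr mxtraceD. Qed.

Lemma frobeniusZl (R : realType) m n a (A B : 'M[R]_(m, n)) :
  frobenius (a *: A) B = a * frobenius A B.
Proof. by rewrite /frobenius linearZ -scalemxAl mxtraceZ. Qed.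

Lemma frobeniusNl (R : realType) m n (A B : 'M[R]_(m, n)) :
  frobenius (- A) B = - frobenius A B.
Proof. by rewrite -scaleN1r frobeniusZl mulN1r. Qed.

Lemma frobeniusNr (R : realType) m n (A B : 'M[R]_(m, n)) :
  frobenius A (- B) = - frobenius A B.
Proof. by rewrite /frobenius mulmxN raddfN. Qed.

Lemma frobenius_tr (R : realType) m n (A B : 'M[R]_(m, n)) :
  frobenius A^T B^T = frobenius A B.
Proof. by rewrite /frobenius -trmx_mul mxtrace_tr mxtrace_mulC. Qed.

Lemma frobenius_mulmxr (R : realType) m n p (A : 'M[R]_(m, n))
    (B : 'M[R]_(m, p)) (C : 'M[R]_(p, n)) :
  frobenius A (B *m C) = frobenius (A *m C^T) B.
Proof.
by rewrite /frobenius trmx_mul trmxK mulmxA mxtrace_mulC mulmxA.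
Qed.

Lemma frobenius_mulmxl (R : realType) m n p (A : 'M[R]_(m, n))
    (B : 'M[R]_(m, p)) (C : 'M[R]_(p, n)) :
  frobenius A (B *m C) = frobenius (B^T *m A) C.
Proof. by rewrite /frobenius trmx_mul trmxK mulmxA. Qed.

Lemma frobenius_symmx (R : realType) n (A B : 'M[R]_n) :
  B^T = B -> frobenius (symmx_part A) B = frobenius A B.
Proof.
move=> Bs; rewrite /symmx_part frobeniusZl frobeniusDl.
by rewrite -{2}Bs frobenius_tr; lra.
Qed.

Lemma symmx_part_tr (R : realType) n (A : 'M[R]_n) :
  (symmx_part A)^T = symmx_part A.
Proof. by rewrite /symmx_part linearZ linearD/= trmxK addrC. Qed.

(** The two terms of [dgram M h] are transposes of each other, so they pair
    equally with a symmetric matrix. *)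
Lemma frobenius_dgram (R : realType) m n (M h : 'M[R]_(m, n)) (X : 'M[R]_n) :
  X^T = X -> frobenius X (dgram M h) = frobenius (2 *: (M *m X)) h.
Proof.
move=> Xs; rewrite frobeniusZl /dgram frobeniusDr.
have -> : frobenius X (h^T *m M) = frobenius X (M^T *m h).
  by rewrite -frobenius_tr Xs trmx_mul trmxK.
by rewrite frobenius_mulmxl trmxK; lra.
Qed.

(** Splitting [(u, v)] as [(u, 0) + (0, v)] recovers a differential from its
    partial differentials. *)
Lemma diff_pair_partial (R : realType) (U U' V : normedModType R)
    (f : U * U' -> V) (x : U) (y : U') : differentiable f (x, y) ->
  forall u v, 'd f (x, y) (u, v) =
    'd (fun x' => f (x', y)) x u + 'd (fun y' => f (x, y')) y v.
Proof.
move=> df u v.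
have -> : (u, v) = (u, 0) + (0, v) by rewrite -[RHS]/(u + 0, 0 + v) addr0 add0r.
rewrite linearD; congr (_ + _).
- have D : is_diff x (fun x' : U => (x', y)) (fun u' : U => (u', 0)).
    by apply: is_diff_pair.
  transitivity ('d (f \o (fun x' => (x', y))) x u); last by [].
  by rewrite (@diff_comp _ _ _ _ (fun x' => (x', y)) f)//= diff_val.
- have D : is_diff y (fun y' : U' => (x, y')) (fun v' : U' => (0, v')).
    by apply: is_diff_pair.
  transitivity ('d (f \o (fun y' => (x, y'))) y v); last by [].
  by rewrite (@diff_comp _ _ _ _ (fun y' => (x, y')) f)//= diff_val.
Qed.

Theorem theorem5p1 (R : realType) (m n : nat) (hmn : (n <= m)%N)
    (M W : 'M[R]_(m, n)) (H V : 'M[R]_n) (sigma : 'rV[R]_n)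
    (hM : \rank M = n)
    (hWH : is_polar M W H)
    (hV : V^T *m V = 1%:M)
    (hH : H = V *m diag_mx sigma *m V^T)
    (ell : 'M[R]_(m, n) * 'M[R]_n -> R)
    (Wbar : 'M[R]_(m, n)) (Hbar : 'M[R]_n)
    (hell : differentiable ell (W, H))
    (hWbar : is_gradient (fun W' => ell (W', H)) W Wbar)
    (hHbar : is_gradient (fun H' => ell (W, H')) H Hbar) :
  let L := fun M' => ell (polar_factors M') in
  let C := symmx_part (Hbar - W^T *m Wbar *m invmx H) in
  let T := \matrix_(i < n, j < n)
    (if 0 < sigma 0 i + sigma 0 j then (sigma 0 i + sigma 0 j)^-1 else 0) in
  let X := V *m hadamard T (V^T *m C *m V) *m V^T in
  is_gradient L M (Wbar *m invmx H + 2 *: (M *m X)).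
Proof.
move=> L C T X.
have Hu := polar_rank_unitmx hM hWH.
have [MWH WW psdH] := hWH; have Hs := psdH.1.
have sigma_gt0 := spectral_gt0 hV hH psdH Hu.
have [dpol dpolE] := polar_factors_diff hWH hV hH sigma_gt0 Hu.
have polM := polar_factors_full_rank hWH hV hH sigma_gt0 Hu.
have dell : differentiable ell (polar_factors M) by rewrite polM.
split=> [|h]; first exact: (differentiable_comp dpol dell).
transitivity ('d (ell \o @polar_factors R m n) M h); first by [].
rewrite diff_comp//= dpolE polM (diff_pair_partial hell).
rewrite (hWbar.2) (hHbar.2) -/X.
set dH := dpolar_H M V sigma h.
have dHs : dH^T = dH.
  rewrite /dH sylvester_tr /dgram linearD/= !trmx_mul !trmxK.
  by congr sylvester; rewrite addrC.
have Xs : X^T = X by rewrite (sylvester_tr V sigma C) symmx_part_tr.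
rewrite frobeniusDl -(frobenius_dgram M h Xs).
rewrite (sylvester_selfadjoint hV hH sigma_gt0 C) -/dH.
rewrite frobenius_symmx// /dpolar_W -/dH frobenius_mulmxr trmx_inv Hs.
rewrite [frobenius (Hbar - _) _]frobeniusDl frobeniusDr frobeniusNl frobeniusNr.
by rewrite frobenius_mulmxl mulmxA -addrA [- _ + _]addrC.
Qed.
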